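(* Let $A,B$ be non-zero integers such that the roots $\alpha,\beta$ of $x^2-Ax-B$ have the property that $\alpha/\beta$ is not a root of unity, and assume $A^2+4B>0$. Let $u=(u_n)_{n\ge0}$ (resp. $v=(v_n)_{n\ge0}$) be the Lucas sequence of the first (resp. second) kind corresponding to $(A,B)$. If $u$ contains more than two three term arithmetic progressions, then $u$ contains infinitely many three term arithmetic progressions. If $v$ contains more than one three term arithmetic progression, then $v$ contains infinitely many three term arithmetic progressions.
   Context: For non-zero integers $A,B$ such that the ratio $\alpha/\beta$ of the roots of $x^2-Ax-B$ is not a root of unity, the Lucas sequences of the first and second kind corresponding to $(A,B)$ are defined by $u_{n+2}=Au_{n+1}+Bu_n$, $v_{n+2}=Av_{n+1}+Bv_n$ for $n\ge 0$, with $u_0=0$, $u_1=1$, $v_0=2$, $v_1=A$. Three term arithmetic progressions in a sequence $w$ are counted as triples $(k,l,m)$ of non-negative integers such that $w_k<w_l<w_m$ and $w_k+w_m=2w_l$. *)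

(* Defs.v *)
From HB Require Import structures.
From mathcomp Require Import all_boot all_order all_algebra all_field.
From mathcomp Require Import boolp classical_sets functions cardinality.

Set Implicit Arguments.
Unset Strict Implicit.
Unset Printing Implicit Defensive.

Import Order.TTheory GRing.Theory Num.Theory.

Local Open Scope ring_scope.
Local Open Scope classical_set_scope.

Fixpoint binary_rec (A B w0 w1 : int) (n : nat) : int :=
  match n with
  | 0%N => w0
  | 1%N => w1
  | (n'.+1 as m).+1 => A * binary_rec A B w0 w1 m + B * binary_rec A B w0 w1 n'
  end.

Definition lucasU (A B : int) : nat -> int := binary_rec A B 0 1.

Definition lucasV (A B : int) : nat -> int := binary_rec A B 2 A.

Definition char_poly_lucas (A B : int) : {poly int} := 'X^2 - A *: 'X - B%:P.

(* The condition 0 < n is needed: every z satisfies 0.-unity_root z. *)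
Definition is_root_of_unity (z : algC) : Prop :=
  exists2 n : nat, (0 < n)%N & n.-unity_root z.

(* Progressions are counted as triples of indices, not of values; the indices
   themselves need not be increasing. *)
Definition AP3 (w : nat -> int) : set (nat * nat * nat) :=
  [set t | let: (k, l, m) := t in
     [/\ w k < w l, w l < w m & w k + w m = w l *+ 2]].

(* Main.v *)
(** Let x be the sequence for (|A|, B); for A < 0 the sequence in question is x
with alternating signs. Since the dominant root is real, x grows so fast that,
outside |A| = 1 and B in {1, 2}, a progression can only occur among the first
few terms. For A > 0 and l large, x_(l+1) + x_k > 2 x_l rules out every choice
of the largest term. For A < 0 the term of largest index M must be an extreme
term of the progression, and comparing x_M with the two other terms forces
M = 2 and middle index 0. The exceptional pairs satisfy three-term relations
that produce infinite families: 2 w_(n+2) = w_n + w_(n+3) for (1, 1),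
2 w_(n+1) = w_n + w_(n+3) for (-1, 1), 2 w_n = w_(n+1) + w_(n+2) for (-1, 2),
and 2 u_n = u_(n+1) + u_1, for odd n, for (1, 2). *)

Require Import Defs.
From mathcomp Require Import all_boot all_order all_algebra all_field.
From mathcomp Require Import boolp classical_sets functions cardinality.
From mathcomp Require Import zify.

Import Order.TTheory GRing.Theory Num.Theory.

Local Open Scope ring_scope.
Local Open Scope classical_set_scope.
Local Open Scope card_scope.

(** * Counting progressions *)

(** Turns an exhaustive list into an upper bound: [A] lies in the image under [nth] of the first
    [size s] indices. *)
Lemma card_le_seq (T : choiceType) (A : set T) (s : seq T) (n : nat) :
  (forall t, A t -> t \in s) -> `I_n #<= A -> (n <= size s)%N.
Proof.
case: s => [|x0 s'] As nA.
  case: n nA => [//|n] nA; exfalso.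
  have A0 : A = set0 by apply/seteqP; split=> t // /As.
  by move: nA; rewrite A0 card_le0 => /eqP/seteqP[] /(_ 0%N) /(_ isT).
rewrite -card_le_II; apply: card_le_trans nA _.
apply: card_le_trans (card_image_le (nth x0 (x0 :: s')) _).
by apply: subset_card_le => t /As /(nthP x0)[i ilt <-]; exists i.
Qed.

Lemma infinite_AP3 (w : nat -> int) (f : nat -> nat * nat * nat) :
  injective f -> (forall n, AP3 w (f n)) -> infinite_set (AP3 w).
Proof.
move=> injf wf; apply/infiniteP.
rewrite -(card_le_eql (inj_card_eq (A := [set: nat]) (in2W injf))).
by apply: subset_card_le => _ [n _ <-].
Qed.

Lemma AP3E (w : nat -> int) k l m :
  AP3 w (k, l, m) -> [/\ w k < w l, w l < w m & w k + w m = w l *+ 2].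
Proof. by []. Qed.

(** * Sequences increasing from index 2 on *)

(** Indices 0 and 1 are not compared and may tie with index 2: for [A = 1], u_1 = u_2 = 1 and v_0 =
    2 > v_1 = 1. *)
Definition increasing_from2 (x : nat -> int) : Prop :=
  [/\ x 0%N <= x 2%N, x 1%N <= x 2%N & forall n, x n.+2 < x n.+3].

Lemma le_from2 (x : nat -> int) i n : increasing_from2 x ->
  (i <= n)%N -> (1 < n)%N -> x i <= x n.
Proof.
move=> [x02 x12 incx].
elim: n => [//|n IHn]; rewrite leq_eqVlt ltnS => /orP[/eqP-> //|lein].
case: n IHn lein => [//|[|n]] IHn lein _.
  by case: i {IHn} lein => [|[|]].
by apply: le_trans (IHn _ _) (ltW (incx _)).
Qed.

Lemma lt_from2 (x : nat -> int) i n : increasing_from2 x ->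
  (1 < n)%N -> x n < x i -> (n < i)%N.
Proof.
move=> incx n1; rewrite [(n < i)%N]ltnNge; apply: contraTN => lein.
by rewrite -leNgt; apply: le_from2.
Qed.

Lemma AP3_succ_le (x : nat -> int) k l m : increasing_from2 x -> (1 < l)%N ->
  AP3 x (k, l, m) -> x k + x l.+1 <= 2 * x l.
Proof.
move=> incx l1 /AP3E[kl lm klm].
have ltlm := lt_from2 _ _ _ incx l1 lm.
have := le_from2 _ _ _ incx ltlm (ltn_trans l1 ltlm); lia.
Qed.

Lemma AP3_succ (x : nat -> int) k l m : increasing_from2 x -> (1 < l)%N ->
  2 * x l < x k + x l.+2 -> AP3 x (k, l, m) -> m = l.+1.
Proof.
move=> incx l1 xl2 /AP3E[kl lm klm].
have ltlm := lt_from2 _ _ _ incx l1 lm.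
have [//|lt2m] : m = l.+1 \/ (l.+2 <= m)%N by lia.
have := le_from2 _ _ _ incx lt2m ltac:(lia); lia.
Qed.

(** * Progressions in sequences with alternating signs *)

(** The growth conditions under which x, with alternating signs, has no
progression among its terms except on the indices 0, 1, 2. *)
Record steep (x : nat -> int) : Prop := Steep {
  steep_ge0 : 0 <= x 0%N;
  steep_gt0 : forall n, 0 < x n.+1;
  steep_increasing : increasing_from2 x;
  steep_03 : 2 * x 0%N + x 1%N < x 3%N;
  steep_13 : 2 * x 1%N + x 0%N < x 3%N;
  steep_skip1 : forall n, 3 * x n.+2 < x n.+4;
  steep_neq : forall n, x n.+2 + 2 * x n.+1 <> x n.+3;
  steep_04 : x 3%N + 2 * x 0%N < x 4%N;
  steep_skip2 : forall n, x n.+3 + 2 * x n.+1 < x n.+4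
}.

Lemma steep_alternating x w e k l m : steep x ->
  (forall n, w n = (-1) ^+ (n + e) * x n) -> AP3 w (k, l, m) ->
  (k, l, m) = if w 1%N < w 2%N then (1%N, 0%N, 2%N) else (2%N, 0%N, 1%N).
Proof.
move=> sx wE /AP3E[kl lm klm].
have incx := steep_increasing _ sx.
have lt_incx n : x n.+2 < x n.+3 by case: incx.
have x_ge0 n : 0 <= x n.
  by case: n => [|n]; [apply: steep_ge0|apply/ltW/steep_gt0].
have w_opp i : (w i = x i /\ w i.+1 = - x i.+1) \/
    (w i = - x i /\ w i.+1 = x i.+1).
  rewrite !wE addSn exprS; have := signr_odd int (i + e).
  by case: odd => <-; [right|left]; split; rewrite /=; lia.
have w_pm i : w i = x i \/ w i = - x i by have := w_opp i; tauto.
(* [M] is the largest index and an end of the progression, [j] is the other end. *)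
suff H M j : (M = k /\ j = m) \/ (M = m /\ j = k) -> (j < M)%N -> (l < M)%N ->
    [/\ l = 0%N, j = 1%N & M = 2%N].
  have nkm : k <> m by move=> E; move: kl lm; rewrite E; lia.
  have nkl : k <> l by move=> E; move: kl; rewrite E; lia.
  have nlm : l <> m by move=> E; move: lm; rewrite E; lia.
  (* The middle index cannot be the largest: both ends are at most [x l] in absolute value, so their
     mean is [w l] only if all three terms agree. *)
  have [/andP[kltl mltl]|lkm] := boolP ((k < l)%N && (m < l)%N).
    have l1 : (1 < l)%N by lia.
    have := le_from2 _ _ _ incx (ltnW kltl) l1.
    have := le_from2 _ _ _ incx (ltnW mltl) l1.
    have := x_ge0 k; have := x_ge0 m; have := x_ge0 l.
    have := w_pm k; have := w_pm m; have := w_pm l; lia.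
  have [mk|km] := ltnP m k.
    have [] := H k m; [by left|by []|lia|] => El Em Ek.
    by move: kl lm; rewrite El Em Ek => ? ?; case: ltP => //; lia.
  have [] := H m k; [by right|lia|lia|] => El Em Ek.
  by move: kl lm; rewrite El Em Ek => ? ?; case: ltP => //; lia.
move=> Mj ltjM ltlM.
have wMj : w M + w j = 2 * w l by case: Mj => -[-> ->]; lia.
have njl : j <> l.
  by move=> E; case: Mj kl lm => -[_ <-]; rewrite E; lia.
have {Mj kl lm klm} M1 : (1 < M)%N by lia.
case: M M1 ltjM ltlM wMj => [|[|N]] // _; rewrite !ltnS => ltjM ltlM wMj.
have xjM : x j <= x N.+2 by apply: le_from2 => //; apply: leqW.
(* Otherwise [w l] and [w M] have opposite signs, and [2 * w l - w M] exceeds [x M] in absolute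
   value, hence cannot be [w j]. *)
have lneq : l <> N.+1.
  move=> El; move: njl wMj xjM; rewrite El.
  have := w_opp N.+1; have := steep_gt0 _ sx N; have := w_pm j.
  have := x_ge0 j; have := steep_gt0 _ sx N.+1; lia.
case: N => [|N] in ltjM ltlM wMj xjM lneq *; first by split; lia.
exfalso.
have {}ltlM : (l <= N.+1)%N by lia.
have [Ej|ltjN] : j = N.+2 \/ (j <= N.+1)%N by lia.
  (* Here w_M and w_l would have opposite signs. *)
  have lneqN : l <> N.
    move=> El; move: wMj; rewrite Ej El.
    have := w_opp N; have := w_opp N.+1; have := w_opp N.+2.
    have := lt_incx N; have := x_ge0 N; have := steep_gt0 _ sx N.
    have := steep_gt0 _ sx N.+1; lia.
  (* [w M] and [w j] are consecutive, so their sum has absolute value [x M - x j]. *)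
  have xN : x N.+3 = x N.+2 + 2 * x l.
    move: wMj; rewrite Ej.
    have := w_opp N.+2; have := w_pm l; have := lt_incx N.
    have := x_ge0 l; have := steep_gt0 _ sx N.+1; lia.
  have [El|ltlN] : l = N.+1 \/ (l < N)%N by lia.
    by apply: (steep_neq _ sx N); rewrite xN El.
  move: {lneqN lneq ltjM ltlM wMj xjM Ej} N ltlN xN => [//|[|N]] ltlN xN.
    by move: xN (steep_04 _ sx); rewrite (_ : l = 0%N); lia.
  have := le_from2 _ l N.+2 incx ltac:(lia) isT; have := steep_skip2 _ sx N.+1; lia.
have xN : x N.+3 <= x j + 2 * x l.
  have := w_pm j; have := w_pm l; have := w_pm N.+3.
  have := x_ge0 l; have := x_ge0 j; have := x_ge0 N.+3; lia.
move: {lneq ltjM wMj xjM} N ltlM ltjN xN => [|N] ltlM ltjN xN.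
  have [[El Ej]|[El Ej]] : l = 0%N /\ j = 1%N \/ l = 1%N /\ j = 0%N by lia.
    by move: xN (steep_03 _ sx); rewrite El Ej; lia.
  by move: xN (steep_13 _ sx); rewrite El Ej; lia.
have := le_from2 _ _ _ incx ltlM isT; have := le_from2 _ _ _ incx ltjN isT.
have := steep_skip1 _ sx N; lia.
Qed.

(** * Recurrences and the sign of [A] *)

Lemma binary_recS A B w0 w1 n : binary_rec A B w0 w1 n.+2 =
  A * binary_rec A B w0 w1 n.+1 + B * binary_rec A B w0 w1 n.
Proof. by []. Qed.

Lemma lucasU0 A B : lucasU A B 0%N = 0. Proof. by []. Qed.
Lemma lucasU1 A B : lucasU A B 1%N = 1. Proof. by []. Qed.
Lemma lucasV0 A B : lucasV A B 0%N = 2. Proof. by []. Qed.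
Lemma lucasV1 A B : lucasV A B 1%N = A. Proof. by []. Qed.

Lemma lucasUS A B n :
  lucasU A B n.+2 = A * lucasU A B n.+1 + B * lucasU A B n.
Proof. by []. Qed.

Lemma lucasVS A B n :
  lucasV A B n.+2 = A * lucasV A B n.+1 + B * lucasV A B n.
Proof. by []. Qed.

Lemma nat_ind2 (P : nat -> Prop) :
  P 0%N -> P 1%N -> (forall n, P n -> P n.+1 -> P n.+2) -> forall n, P n.
Proof.
move=> P0 P1 PS n; suff [] : P n /\ P n.+1 by [].
by elim: n => [//|n [Pn PSn]]; split=> //; apply: PS.
Qed.

(** The shift [e] absorbs the signs of the initial values: 1 for the first kind, 0 for the
    second. *)
Lemma binary_rec_opp A B x0 x1 w0 w1 e :
  w0 = (-1) ^+ e * x0 -> w1 = (-1) ^+ e.+1 * x1 ->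
  forall n, binary_rec (- A) B w0 w1 n =
    (-1) ^+ (n + e) * binary_rec A B x0 x1 n.
Proof.
move=> w0E w1E; elim/nat_ind2 => [//|//|n IH0 IH1].
rewrite !binary_recS IH0 IH1 !addSn !exprS; lia.
Qed.

Lemma lucasU_opp A B n :
  lucasU (- A) B n = (-1) ^+ (n + 1) * lucasU A B n.
Proof. by apply: binary_rec_opp. Qed.

Lemma lucasV_opp A B n :
  lucasV (- A) B n = (-1) ^+ (n + 0) * lucasV A B n.
Proof. by apply: binary_rec_opp; rewrite ?expr0 ?expr1 ?mul1r ?mulN1r. Qed.

(** * Growth for positive [A] *)

(** Doubling is strict only from index 2 because u_2 = 2 u_1 when [A = 2]. *)
Lemma steep_double (x : nat -> int) : 0 <= x 0%N -> x 0%N <= x 1%N ->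
  0 < x 1%N -> (forall n, 2 * x n.+1 <= x n.+2) ->
  (forall n, 2 * x n.+2 < x n.+3) -> steep x.
Proof.
move=> x0 x01 x1 x2 x3.
have x_gt0 n : 0 < x n.+1 by elim: n => // n IHn; have := x2 n; lia.
have := x2 0%N; have := x2 1%N; have := x2 2%N; have := x3 0%N; have := x3 1%N.
split=> //; try lia.
- split=> [||n]; try lia.
  by have := x3 n; have := x_gt0 n.+1; lia.
- by move=> n; have := x3 n; have := x3 n.+1; have := x_gt0 n.+1; lia.
- by move=> n; have := x3 n; have := x2 n; lia.
- by move=> n; have := x3 n.+1; have := x3 n; have := x2 n; have := x_gt0 n; lia.
Qed.

(** The pair (3, -2) has roots 1 and 2; there v_n = 2^n + 1 and strict doubling fails. *)
Lemma rec_neg_double (A B : int) (x : nat -> int) :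
  (forall n, x n.+2 = A * x n.+1 + B * x n) ->
  0 < A -> B < 0 -> 0 < A ^+ 2 + 4 * B -> (A, B) <> (3, -2) ->
  0 <= x 0%N -> 0 < x 1%N -> A * x 0%N <= 2 * x 1%N ->
  forall n, 2 * x n.+1 < x n.+2.
Proof.
rewrite expr2 => xS A0 B0 D AB x0 x1 x01.
have A3 : 3 <= A by nia.
(* The ratio of consecutive terms stays above A/2, the larger root being > A/2. *)
have ratio n : [/\ 0 <= x n, 0 < x n.+1 & A * x n <= 2 * x n.+1].
  elim: n => [//|n [xn xn1 ratio]].
  have : A * x n.+1 <= 2 * x n.+2.
    have : 0 <= (A * A + 4 * B) * x n by apply: mulr_ge0 => //; lia.
    have : 0 <= A * (2 * x n.+1 - A * x n) by apply: mulr_ge0; lia.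
    by rewrite xS; lia.
  by split=> //; nia.
move=> n; have [xn xn1 xr] := ratio n; have [_ xn2 xr1] := ratio n.+1.
(* For [A >= 4] a ratio above [A / 2] suffices; for [A = 3] only [B = -1] is left, where the claim
   reduces to [x n < x n.+1]. *)
have [A4|A4] : 4 <= A \/ A = 3 by lia.
  have xlt : A * x n.+1 < 2 * x n.+2.
    have [x_eq0|x_gt0] : x n = 0 \/ 0 < x n by lia.
      by rewrite xS x_eq0; nia.
    have : 0 < (A * A + 4 * B) * x n by apply: mulr_gt0.
    have : 0 <= A * (2 * x n.+1 - A * x n) by apply: mulr_ge0; lia.
    by rewrite xS; lia.
  have : 0 <= (A - 4) * x n.+1 by apply: mulr_ge0; lia.
  lia.
have B1 : B = -1.
  have [//|B2] : B = -1 \/ B = -2 by rewrite A4 in D; lia.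
  by case: AB; rewrite A4 B2.
by rewrite xS A4 B1; rewrite A4 in xr; lia.
Qed.

(** The quantity [x n.+1 - 2 * x n] is multiplied at each step by the other root, which is 1. *)
Lemma rec_3_m2 (x : nat -> int) :
  (forall n, x n.+2 = 3 * x n.+1 + -2 * x n) ->
  forall n, x n.+1 = 2 * x n + (x 1%N - 2 * x 0%N).
Proof. by move=> xS; elim=> [|n IHn]; [|rewrite xS]; lia. Qed.

Lemma rec_pos (A B : int) (x : nat -> int) :
  (forall n, x n.+2 = A * x n.+1 + B * x n) ->
  0 < A -> 0 < B -> 0 <= x 0%N -> 0 < x 1%N ->
  forall n, 0 <= x n /\ 0 < x n.+1.
Proof.
move=> xS A0 B0 x0 x1; elim=> [//|n [xn xn1]]; split; first lia.
rewrite xS; have : 0 < A * x n.+1 by apply: mulr_gt0.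
have : 0 <= B * x n by apply: mulr_ge0; lia.
lia.
Qed.

Lemma rec_pos_double (A B : int) (x : nat -> int) :
  (forall n, x n.+2 = A * x n.+1 + B * x n) ->
  2 <= A -> 0 < B -> 0 <= x 0%N -> 0 < x 1%N ->
  forall n, 2 * x n.+1 + x n <= x n.+2.
Proof.
move=> xS A2 B0 x0 x1 n.
have [xn xn1] := rec_pos A B x xS ltac:(lia) B0 x0 x1 n.
rewrite xS; have : 0 <= (A - 2) * x n.+1 by apply: mulr_ge0; lia.
have : 0 <= (B - 1) * x n by apply: mulr_ge0; lia.
lia.
Qed.

(** All conditions come from [B * x n >= 3 * x n]. For [B = 2] the recurrence itself is the equality
    that [steep_neq] forbids. *)
Lemma steep_rec1 (B : int) (x : nat -> int) :
  (forall n, x n.+2 = x n.+1 + B * x n) ->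
  3 <= B -> 0 <= x 0%N -> 0 < x 1%N -> steep x.
Proof.
move=> xS B3 x0 x1.
have pos n : 0 <= x n /\ 0 < x n.+1.
  by apply: (rec_pos 1 B) => // [i|]; [rewrite mul1r|lia].
have Bx n : 3 * x n <= B * x n.
  have [xn _] := pos n.
  have : 0 <= (B - 3) * x n by apply: mulr_ge0; lia.
  lia.
have := xS 0%N; have := xS 1%N; have := xS 2%N.
have := Bx 0%N; have := Bx 1%N; have := Bx 2%N.
have := pos 0%N; have := pos 1%N; have := pos 2%N.
split; try lia; last first.
- move=> n; rewrite [x n.+4]xS; have := Bx n.+2; have := xS n.+1.
  have := xS n; have := pos n; have := pos n.+1; have := Bx n; lia.
- by move=> n; rewrite [x n.+3]xS; have := Bx n.+1; have := pos n; lia.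
- by move=> n; rewrite [x n.+4]xS; have := Bx n.+2; have := pos n.+2; lia.
- split=> [||n]; try lia.
  by rewrite [x n.+3]xS; have := Bx n.+1; have := pos n; lia.
- by move=> n; have := pos n; lia.
Qed.

Lemma steep_lucasU (A B : int) : 0 < A -> B != 0 -> 0 < A ^+ 2 + 4 * B ->
  (A = 1 -> 3 <= B) -> steep (lucasU A B).
Proof.
move=> A0 B0 D A1.
have US := lucasUS A B.
have [A_1|A2] : A = 1 \/ 2 <= A by lia.
  by apply: (steep_rec1 B) => // [n|]; [rewrite US A_1 mul1r|apply: A1].
have [Bneg|Bpos] : B < 0 \/ 0 < B by lia.
  have dbl n : 2 * lucasU A B n.+1 < lucasU A B n.+2.
    have [[A3 B2]|AB] := EM ((A, B) = (3, -2)).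
      by subst A B; have := rec_3_m2 _ US n.+1; rewrite lucasU0 lucasU1; lia.
    by apply: (rec_neg_double A B) => //; rewrite lucasU0 mulr0.
  by apply: steep_double => // n; apply: ltW.
have dbl := rec_pos_double A B _ US A2 Bpos (lexx 0) ltr01.
have pos := rec_pos A B _ US A0 Bpos (lexx 0) ltr01.
by apply: steep_double => // n; [have := dbl n; have := pos n
  |have := dbl n.+1; have := pos n]; lia.
Qed.

Lemma steep_lucasV (A B : int) : 0 < A -> B != 0 -> 0 < A ^+ 2 + 4 * B ->
  (A = 1 -> 3 <= B) -> steep (lucasV A B).
Proof.
move=> A0 B0 D A1.
have VS := lucasVS A B.
have [A_1|A2] : A = 1 \/ 2 <= A by lia.
  by apply: (steep_rec1 B) => // [n|]; [rewrite VS A_1 mul1r|apply: A1].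
have [Bneg|Bpos] : B < 0 \/ 0 < B by lia.
  have [[A3 B2]|AB] := EM ((A, B) = (3, -2)).
    (* Here v_(n+1) = 2 v_n - 1, just short of doubling, so the fields of [steep] are checked
       directly. *)
    subst A B; have V2 := rec_3_m2 _ VS.
    rewrite lucasV0 lucasV1 in V2.
    have V3 n : 3 <= lucasV 3 (-2) n.+1.
      by elim: n => // n; have := V2 n.+1; lia.
    split=> // [n||n|n|n].
    - by have := V3 n; lia.
    - by split=> // n; have := V2 n.+2; have := V3 n.+1; lia.
    - by have := V2 n.+3; have := V2 n.+2; have := V2 n.+1; have := V3 n; lia.
    - by have := V2 n.+2; have := V2 n.+1; lia.
    - by have := V2 n.+3; have := V2 n.+2; have := V2 n.+1; have := V3 n; lia.
  have dbl n : 2 * lucasV A B n.+1 < lucasV A B n.+2.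
    by apply: (rec_neg_double A B) => //; rewrite lucasV0 lucasV1; lia.
  by apply: steep_double => // n; apply: ltW.
have dbl := rec_pos_double A B _ VS A2 Bpos isT A0.
have pos := rec_pos A B _ VS A0 Bpos isT A0.
by apply: steep_double => // n; [have := dbl n; have := pos n
  |have := dbl n.+1; have := pos n]; lia.
Qed.

Lemma lucasU_double (A B : int) : 2 <= A -> B != 0 -> 0 < A ^+ 2 + 4 * B ->
  forall n, 2 * lucasU A B n.+2 < lucasU A B n.+3.
Proof.
move=> A2 B0 D n; have US := lucasUS A B.
have [Bneg|Bpos] : B < 0 \/ 0 < B by lia.
  have [[A3 B2]|AB] := EM ((A, B) = (3, -2)).
    subst A B; have := rec_3_m2 _ US n.+2; rewrite lucasU0 lucasU1; lia.
  apply: (rec_neg_double A B) => //; rewrite ?lucasU0 ?mulr0 //; lia.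
have A0 : 0 < A by lia.
have := rec_pos_double A B _ US A2 Bpos (lexx 0) ltr01 n.+1.
have := rec_pos A B _ US A0 Bpos (lexx 0) ltr01 n; lia.
Qed.

(** The slack 1 accommodates (3, -2); it is harmless later because every term of the sequence is at
    least 2. *)
Lemma lucasV_double (A B : int) : 2 <= A -> B != 0 -> 0 < A ^+ 2 + 4 * B ->
  forall n, 2 * lucasV A B n.+1 <= lucasV A B n.+2 + 1.
Proof.
move=> A2 B0 D n; have VS := lucasVS A B.
have A0 : 0 < A by lia.
have [Bneg|Bpos] : B < 0 \/ 0 < B by lia.
  have [[A3 B2]|AB] := EM ((A, B) = (3, -2)).
    subst A B; have := rec_3_m2 _ VS n.+1; rewrite lucasV0 lucasV1; lia.
  suff : 2 * lucasV A B n.+1 < lucasV A B n.+2 by lia.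
  by apply: (rec_neg_double A B) => //; rewrite ?lucasV0 ?lucasV1; lia.
have := rec_pos_double A B _ VS A2 Bpos isT A0 n.
have := rec_pos A B _ VS A0 Bpos isT A0 n; lia.
Qed.

(** * Progressions for [A >= 2] *)

(** Doubling excludes a middle index above 1, and u_0 = 0 is minimal, so the middle term is u_1 = 1.
    The triple is a progression exactly when [A = 2]. *)
Lemma AP3_lucasU_ge2 (A B : int) t : 2 <= A -> B != 0 ->
  0 < A ^+ 2 + 4 * B -> AP3 (lucasU A B) t -> t = (0%N, 1%N, 2%N).
Proof.
case: t => [[k l] m] A2 B0 D AP.
have sU : steep (lucasU A B) by apply: steep_lucasU => //; lia.
have incU := steep_increasing _ sU.
have U0 n : 0 <= lucasU A B n by case: n => // n; apply/ltW/steep_gt0.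
have [l1|l1] := ltnP 1 l.
  have := AP3_succ_le _ _ _ _ incU l1 AP; have := U0 k.
  by case: l l1 {AP} => [|[|l]] // _; have := lucasU_double _ _ A2 B0 D l; lia.
have [kl lm klm] := AP3E _ _ _ _ AP.
case: l l1 kl lm klm {AP} => [|[|]] // _; rewrite ?lucasU0 ?lucasU1 => kl lm klm.
  by have := U0 k; lia.
case: k kl klm => [|k] kl klm; last by have := steep_gt0 _ sU k; lia.
case: m lm klm => [|[|[|m]]]; rewrite ?lucasU0 ?lucasU1 // => lm klm.
have := le_from2 _ 3%N m.+3 incU isT isT; have := lucasU_double _ _ A2 B0 D 0.
have : lucasU A B 2%N = A by rewrite lucasUS lucasU0 lucasU1 mulr0 mulr1 addr0.
lia.
Qed.

Lemma AP3_lucasV_ge2 (A B : int) t : 2 <= A -> B != 0 ->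
  0 < A ^+ 2 + 4 * B -> ~ AP3 (lucasV A B) t.
Proof.
case: t => [[k l] m] A2 B0 D AP.
have dbl := lucasV_double _ _ A2 B0 D.
have sV : steep (lucasV A B) by apply: steep_lucasV => //; lia.
have incV := steep_increasing _ sV.
have V2 n : 2 <= lucasV A B n.
  by case: n => // n; elim: n => // n IHn; have := dbl n; lia.
have [l1|l1] := ltnP 1 l.
  have := AP3_succ_le _ _ _ _ incV l1 AP; have := V2 k.
  by case: l l1 {AP} => [|l] // _; have := dbl l; lia.
have [kl lm klm] := AP3E _ _ _ _ AP.
case: l l1 kl lm klm {AP} => [|[|]] // _ kl lm klm.
  by have := V2 k; move: kl; rewrite lucasV0; lia.
have m2 : (1 < m)%N.
  by case: m lm {klm} => [|[|]] //; rewrite ?lucasV0 ?lucasV1; lia.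
(* [m2] is used twice, as [2 <= m] for the comparison with index 2 and as [1 < m]. *)
have := le_from2 _ _ _ incV m2 m2; have := dbl 0%N; have := V2 k; lia.
Qed.

(** * Progressions for [A = 1] *)

(** The right side equals (B^2 - 2B - 1) x_(n+1) + B (x_(n+1) - x_n), which is positive for [B >= 3]
    once [0 < x n.+1] and [x n <= x n.+1]. This excludes progressions with middle index [n.+4]. *)
Lemma rec1_double (B : int) (x : nat -> int) n :
  (forall n, x n.+2 = x n.+1 + B * x n) ->
  x n.+4.+1 - 2 * x n.+4 = (B ^+ 2 - B - 1) * x n.+1 - B * x n.
Proof. by move=> xS; rewrite !xS expr2; lia. Qed.

(** The values 1, 1 + B, 1 + 2B give two index triples because u_1 = u_2 = 1. *)
Lemma AP3_lucasU_1 (B : int) t : 3 <= B -> AP3 (lucasU 1 B) t ->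
  t \in [:: (1, 3, 4); (2, 3, 4)]%N.
Proof.
case: t => [[k l] m] B3 AP.
have US n : lucasU 1 B n.+2 = lucasU 1 B n.+1 + B * lucasU 1 B n.
  by rewrite lucasUS mul1r.
have sU : steep (lucasU 1 B) by apply: (steep_rec1 B).
have incU := steep_increasing _ sU.
have U0 n : 0 <= lucasU 1 B n by case: n => // n; apply/ltW/steep_gt0.
have U2 : lucasU 1 B 2%N = 1 by rewrite US lucasU0 lucasU1 mulr0 addr0.
have U3 : lucasU 1 B 3%N = 1 + B by rewrite US U2 lucasU1 mulr1.
have U4 : lucasU 1 B 4%N = 1 + 2 * B by rewrite US U3 U2; lia.
have [kl lm klm] := AP3E _ _ _ _ AP.
have [l1|l1] := ltnP 1 l; last first.
  case: l l1 kl lm klm {AP} => [|[|]] // _; rewrite ?lucasU0 ?lucasU1 => kl lm klm.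
    by have := U0 k; lia.
  have m2 : (2 < m)%N by case: m lm {klm} => [|[|[|]]] //; rewrite U2.
  by have := le_from2 _ _ _ incU m2 (ltnW m2); have := U0 k; lia.
have ml : m = l.+1.
  apply: (AP3_succ _ k _ _ incU l1 _ AP).
  have := steep_gt0 _ sU l; rewrite US.
  have : 0 <= (B - 3) * lucasU 1 B l by apply: mulr_ge0 => //; lia.
  have := le_from2 _ _ _ incU (leqnSn l) ltac:(lia); have := U0 k.
  by case: l l1 {AP kl lm klm} => // l _; have := steep_gt0 _ sU l; lia.
subst m; case: l l1 kl lm klm {AP} => [|[|[|[|n]]]] // _ kl lm klm.
- by have := U0 k; lia.
- case: k kl klm => [|[|[|k]]] kl klm; rewrite ?inE //.
    by rewrite lucasU0 in klm; lia.
  by have := le_from2 _ 3%N k.+3 incU isT isT; lia.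
exfalso.
have : 0 <= B * (lucasU 1 B n.+1 - lucasU 1 B n).
  case: n {kl lm klm} => [|[|n]]; first by rewrite lucasU0 lucasU1; lia.
    by rewrite U2 lucasU1 subrr mulr0.
  by case: incU => _ _ /(_ n) ?; apply: mulr_ge0; lia.
have : 0 < (B * B - 2 * B - 1) * lucasU 1 B n.+1.
  by apply: mulr_gt0; [nia|apply: steep_gt0].
have := rec1_double B _ n US; rewrite expr2; have := U0 k; lia.
Qed.

(** The triple is a progression only for [B = 3], with values 1, 31, 61. *)
Lemma AP3_lucasV_1 (B : int) t : 2 <= B -> AP3 (lucasV 1 B) t ->
  t = (1, 4, 5)%N.
Proof.
case: t => [[k l] m] B2 AP.
have VS n : lucasV 1 B n.+2 = lucasV 1 B n.+1 + B * lucasV 1 B n.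
  by rewrite lucasVS mul1r.
have pos := rec_pos 1 B _ (lucasVS 1 B) ltr01 ltac:(lia) isT ltr01.
have BV n : 2 * lucasV 1 B n <= B * lucasV 1 B n.
  have : 0 <= (B - 2) * lucasV 1 B n by apply: mulr_ge0; have := pos n; lia.
  lia.
have V2 : lucasV 1 B 2%N = 1 + 2 * B by rewrite VS lucasV0 lucasV1; lia.
have V3 : lucasV 1 B 3%N = 1 + 3 * B by rewrite VS V2 lucasV1; lia.
have V4 : lucasV 1 B 4%N = 1 + 4 * B + 2 * (B * B) by rewrite VS V3 V2; lia.
have V5 : lucasV 1 B 5%N = 1 + 5 * B + 5 * (B * B) by rewrite VS V4 V3; lia.
have incV : increasing_from2 (lucasV 1 B).
  split=> [||n]; rewrite ?V2 ?lucasV0 ?lucasV1; try lia.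
  by rewrite [lucasV 1 B n.+3]VS; have := BV n.+1; have := pos n; lia.
have [kl lm klm] := AP3E _ _ _ _ AP.
(* With [m = l.+1] the least term is 2 v_l - v_(l+1): this is 1 + B for [l = 2], and 3 or -3 when
   [B = 2]. *)
have Vk : lucasV 1 B k <> 1 + B /\ lucasV 1 B k <> 3 /\
    (lucasV 1 B k < 2 -> k = 1%N) /\ 0 < lucasV 1 B k.
  case: k {kl lm klm AP} => [|[|k]]; rewrite ?lucasV0 ?lucasV1; try lia.
  by have := le_from2 _ 2%N k.+2 incV isT isT; rewrite V2; lia.
have [l1|l1] := ltnP 1 l; last first.
  case: l l1 kl lm klm {AP} => [|[|]] // _; rewrite ?lucasV0 ?lucasV1 => kl lm klm.
    have k1 : k = 1%N by apply Vk.
    have m2 : (1 < m)%N.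
      by case: m lm {klm} => [|[|]] //; rewrite ?lucasV0 ?lucasV1.
    move: klm; rewrite k1 lucasV1; have := le_from2 _ _ _ incV m2 m2; lia.
  lia.
have ml : m = l.+1.
  apply: (AP3_succ _ k _ _ incV l1 _ AP).
  have := pos l; rewrite VS; have := BV l; lia.
subst m; case: l l1 kl lm klm {AP} => [|[|[|[|n]]]] // _ kl lm klm.
- lia.
- by exfalso; rewrite V3 V4 in klm; nia.
have [B_2|B3] : B = 2 \/ 3 <= B by lia.
  exfalso; subst B.
  (* The roots are 2 and -1, so v_i = 2^i + (-1)^i. *)
  have V2n i : lucasV 1 2 i.+1 - 2 * lucasV 1 2 i = 3 \/
      lucasV 1 2 i.+1 - 2 * lucasV 1 2 i = - 3.
    by elim: i => [|i IHi]; [right|rewrite VS; lia].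
  by have := V2n n.+4; lia.
(* Middle index 4 is separate since v_0 > v_1. There v_k = 1 + 3B - B^2, which is below 2, so
   [k = 1]. *)
case: n kl lm klm => [|n] kl lm klm.
  suff -> : k = 1%N by [].
  by apply Vk; rewrite V4 V5 in klm; nia.
exfalso.
have : 0 <= B * (lucasV 1 B n.+2 - lucasV 1 B n.+1).
  apply: mulr_ge0; first lia.
  case: n {kl lm klm} => [|n]; first by rewrite V2 lucasV1; lia.
  by case: incV => _ _ /(_ n); lia.
have : 0 < (B * B - 2 * B - 1) * lucasV 1 B n.+2.
  by apply: mulr_gt0; [nia|have := pos n.+1; lia].
have := rec1_double B _ n.+1 VS; rewrite expr2; lia.
Qed.

(** * Infinite families *)

Lemma infinite_rec11 (x : nat -> int) :
  (forall n, x n.+2 = x n.+1 + x n) -> 0 <= x 0%N -> 0 < x 1%N ->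
  infinite_set (AP3 x).
Proof.
move=> xS x0 x1.
have pos n : 0 <= x n /\ 0 < x n.+1.
  by elim: n => // n [xn xn1]; rewrite xS; lia.
apply: (@infinite_AP3 _ (fun n => (n.+2, n.+4, n.+4.+1))) => [i j []//|n].
have := pos n.+1; have := pos n.+2; have := pos n.
by split=> /=; rewrite !xS; lia.
Qed.

Lemma infinite_alternating_rec11 (x w : nat -> int) e :
  (forall n, x n.+2 = x n.+1 + x n) -> 0 <= x 0%N -> 0 < x 1%N ->
  (forall n, w n = (-1) ^+ (n + e) * x n) -> infinite_set (AP3 w).
Proof.
move=> xS x0 x1 wE.
have pos n : 0 <= x n /\ 0 < x n.+1.
  by elim: n => // n [xn xn1]; rewrite xS; lia.
(* Adding [e] fixes the parity: the first term is negative, the other two positive. *)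
apply: (@infinite_AP3 _ (fun n => let k := (n.*2 + e).+1 in (k, k.+1, k.+3))).
  by move=> i j []; lia.
move=> n; set k := (n.*2 + e)%N.
have odd_ke : odd (k + e) = false by rewrite /k; lia.
have kE : (-1) ^+ (k + e) = 1 :> int by rewrite -signr_odd odd_ke.
have := pos k; have := pos k.+1.
by split=> /=; rewrite !wE !addSn !exprS kE ?xS; lia.
Qed.

Lemma infinite_alternating_rec12 (x w : nat -> int) e :
  (forall n, x n.+2 = x n.+1 + 2 * x n) -> 0 <= x 0%N -> 0 < x 1%N ->
  (forall n, w n = (-1) ^+ (n + e) * x n) -> infinite_set (AP3 w).
Proof.
move=> xS x0 x1 wE.
have pos n : 0 <= x n /\ 0 < x n.+1.
  by elim: n => // n [xn xn1]; rewrite xS; lia.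
(* The parity makes [w k] and [w k.+2] nonnegative and [w k.+1] negative. *)
apply: (@infinite_AP3 _ (fun n => let k := (n.*2 + e)%N in (k.+1, k, k.+2))).
  by move=> i j []; lia.
move=> n; set k := (n.*2 + e)%N.
have odd_ke : odd (k + e) = false by rewrite /k; lia.
have kE : (-1) ^+ (k + e) = 1 :> int by rewrite -signr_odd odd_ke.
have := pos k.
by split=> /=; rewrite !wE !addSn !exprS kE ?xS; lia.
Qed.

(** These are the Jacobsthal numbers (2^n - (-1)^n)/3, with u_(n+1) - 2 u_n = (-1)^n. Starting at
    index 3 keeps the middle term above u_1. *)
Lemma infinite_lucasU_1_2 : infinite_set (AP3 (lucasU 1 2)).
Proof.
have US n : lucasU 1 2 n.+2 = lucasU 1 2 n.+1 + 2 * lucasU 1 2 n.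
  by rewrite lucasUS mul1r.
apply: (@infinite_AP3 _ (fun n => (1, n.*2.+3, n.*2.+4)%N)) => [i j []|n].
  by lia.
have [U1 UE] : 1 <= lucasU 1 2 n.*2.+1 /\
    lucasU 1 2 n.*2.+2 = 2 * lucasU 1 2 n.*2.+1 - 1.
  elim: n => // n [U1 UE]; rewrite doubleS.
  by have := US n.*2.+2; have := US n.*2.+1; lia.
have := US n.*2.+2; have := US n.*2.+1.
by split=> /=; rewrite ?lucasU1; lia.
Qed.

Theorem corollary1 (A B : int) (alpha beta : algC)
    (hA : A != 0) (hB : B != 0)
    (hroots : map_poly intr (char_poly_lucas A B)
              = ('X - alpha%:P) * ('X - beta%:P))
    (hratio : ~ is_root_of_unity (alpha / beta))
    (hdisc : 0 < A ^+ 2 + 4 * B) :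
  (`I_3 #<= AP3 (lucasU A B) -> infinite_set (AP3 (lucasU A B))) /\
  (`I_2 #<= AP3 (lucasV A B) -> infinite_set (AP3 (lucasV A B))).
Proof.
move=> {alpha beta hroots hratio}.
(* A list shorter than [n] containing all progressions contradicts the assumed [n] progressions. *)
have few (w : nat -> int) s n : (size s < n)%N ->
    (forall t, AP3 w t -> t \in s) -> `I_n #<= AP3 w -> infinite_set (AP3 w).
  by move=> sn APs /(card_le_seq _ _ _ _ APs); rewrite leqNgt sn.
have [Apos|Aneg] : 0 < A \/ A < 0 by lia.
  have [A1|A2] : A = 1 \/ 2 <= A by lia.
    subst A; rewrite expr1n in hdisc.
    have [B1|[B2|B3]] : B = 1 \/ B = 2 \/ 3 <= B by lia.
    - subst B; split=> _; apply: infinite_rec11 => // n.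
        by rewrite lucasUS !mul1r.
      by rewrite lucasVS !mul1r.
    - subst B; split=> [_|]; first exact: infinite_lucasU_1_2.
      by apply: (few _ [:: (1, 4, 5)%N]) => // t /AP3_lucasV_1 -> //; rewrite inE.
    split.
      by apply: (few _ [:: (1, 3, 4); (2, 3, 4)]%N) => // t; apply: AP3_lucasU_1.
    apply: (few _ [:: (1, 4, 5)%N]) => // t /AP3_lucasV_1 ->; last by lia.
    by rewrite inE.
  split.
    apply: (few _ [:: (0, 1, 2)%N]) => // t.
    by move=> /(AP3_lucasU_ge2 _ _ _ A2 hB hdisc) ->; rewrite inE.
  by apply: (few _ [::]) => // t /AP3_lucasV_ge2 [].
have [a aE] : {a | A = - a} by exists (- A); rewrite opprK.
subst A; have a0 : 0 < a by lia.
have D : 0 < a ^+ 2 + 4 * B by rewrite -sqrrN.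
(* For [a = 1] the discriminant 1 + 4B is positive, so [B] is at least 1 and only 1 and 2 escape
   steepness. *)
have [[-> /andP[B0 B3]]|aB] : (a = 1 /\ 0 < B < 3) \/ (a = 1 -> 3 <= B).
  have [a1|] := eqVneq a 1; last by right; lia.
  have : 0 < B < 3 \/ 3 <= B by rewrite a1 expr1n in D; lia.
  by tauto.
  have [->|->] : B = 1 \/ B = 2 by lia.
    split=> _.
      apply: (infinite_alternating_rec11 _ _ _ _ _ _ (lucasU_opp 1 1)) => // n.
      by rewrite lucasUS !mul1r.
    apply: (infinite_alternating_rec11 _ _ _ _ _ _ (lucasV_opp 1 1)) => // n.
    by rewrite lucasVS !mul1r.
  split=> _.
    apply: (infinite_alternating_rec12 _ _ _ _ _ _ (lucasU_opp 1 2)) => // n.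
    by rewrite lucasUS mul1r.
  apply: (infinite_alternating_rec12 _ _ _ _ _ _ (lucasV_opp 1 2)) => // n.
  by rewrite lucasVS mul1r.
(* [P] depends on [w] alone, so a one-element list meets both bounds, 3 and 2. *)
have unique w x e (P := if w 1%N < w 2%N then (1, 0, 2)%N else (2, 0, 1)%N) :
    steep x -> (forall n, w n = (-1) ^+ (n + e) * x n) ->
    forall t, AP3 w t -> t \in [:: P].
  by move=> sx wE [[k l] m] /(steep_alternating _ _ _ _ _ _ sx wE) ->; rewrite inE.
split.
  by apply: few (unique _ _ _ (steep_lucasU _ _ a0 hB D aB) (lucasU_opp _ _)).
by apply: few (unique _ _ _ (steep_lucasV _ _ a0 hB D aB) (lucasV_opp _ _)).
Qed.
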